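(* For every $k\geq 1$ and every $b\geq 1$, Max $b$-Save is polynomial-time solvable on $k$-stars (for arbitrary initially burned vertex $s$ and arbitrary $S\subseteq V$).
   Context: A star is a tree consisting of one vertex (its center) adjacent to all other vertices. A $k$-star ($k\ge1$) is a tree obtained from a star by replacing any of its edges by a path of length at most $k$. Firefighter process with budget $b$: given a graph $G=(V,E)$ and a vertex $s\in V$, at time $0$ the vertex $s$ is burned and every other vertex is vulnerable. A protection strategy is a set $\Phi \subseteq V \times \{1,\dots,|V|\}$; vertex $v$ is protected at time $t$ if $(v,t)\in\Phi$. At each time step $t \ge 1$, the vertices $v$ with $(v,t)\in \Phi$ become protected (and stay protected forever), and then every vulnerable vertex (neither burned nor protected) adjacent to a burned vertex becomes burned at time $t+1$. $\Phi$ is valid with respect to budget $b$ if (1) whenever $(v,t)\in\Phi$, $v$ is not burned at time $t$, and (2) for each $t$, at most $b$ pairs $(v,t)$ lie in $\Phi$. A vertex is saved if it is protected or every path from a burned vertex to it contains a protected vertex. Max $b$-Save: given a graph $G=(V,E)$, a burned vertex $s\in V$ and $S\subseteq V$, find a valid strategy with respect to budget $b$ maximizing the number of saved vertices in $S$. *)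

(* Defs.v *)
From HB Require Import structures.
From mathcomp Require Import all_boot all_order all_algebra.
From mathcomp Require Import boolp.

Set Implicit Arguments.
Unset Strict Implicit.
Unset Printing Implicit Defensive.

(** * Polynomial time *)

(* The computation model is the unit-cost random access machine with addition
   and truncated subtraction as its only arithmetic.  An addition lengthens the
   largest stored number by at most one bit, so this model is polynomially
   equivalent to the multitape Turing machine (Cook and Reckhow, 1973).  The
   input is a read-only array, the output a write-only tape. *)
Inductive instr : Type :=
  | Const of nat & nat        (* Const i c     : r_i := c *)
  | AddReg of nat & nat & nat (* AddReg i j l  : r_i := r_j + r_l *)
  | SubReg of nat & nat & nat (* SubReg i j l  : r_i := r_j - r_l, truncated *)
  | LoadInd of nat & nat      (* LoadInd i j   : r_i := r_(r_j) *)
  | StoreInd of nat & nat     (* StoreInd i j  : r_(r_i) := r_j *)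
  | Read of nat & nat         (* Read i j      : r_i := input[r_j] *)
  | Write of nat              (* Write i       : append r_i to the output *)
  | Jump of nat               (* Jump a        : go to instruction a *)
  | JumpZero of nat & nat.    (* JumpZero i a  : go to instruction a if r_i = 0 *)

Definition program : Type := seq instr.

Record config : Type := Config {
  pc : nat;
  regs : nat -> nat;
  outp : seq nat
}.

Definition upd (r : nat -> nat) (i v : nat) : nat -> nat :=
  fun j => if j == i then v else r j.

(* Reading past the end of the input yields 0. *)
Definition exec_instr (w : seq nat) (a : instr) (c : config) : config :=
  let: Config q r o := c in
  match a with
  | Const i v => Config q.+1 (upd r i v) o
  | AddReg i j l => Config q.+1 (upd r i (r j + r l)) o
  | SubReg i j l => Config q.+1 (upd r i (r j - r l)) o
  | LoadInd i j => Config q.+1 (upd r i (r (r j))) o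
  | StoreInd i j => Config q.+1 (upd r (r i) (r j)) o
  | Read i j => Config q.+1 (upd r i (nth 0 w (r j))) o
  | Write i => Config q.+1 r (rcons o (r i))
  | Jump t => Config t r o
  | JumpZero i t => Config (if r i == 0 then t else q.+1) r o
  end.

Definition halted (P : program) (c : config) : bool := size P <= pc c.

(* A halted configuration is left unchanged. *)
Definition step (P : program) (w : seq nat) (c : config) : config :=
  if halted P c then c else exec_instr w (nth (Jump 0) P (pc c)) c.

Definition init_config : config := Config 0 (fun => 0) [::].

Definition outputs_within (P : program) (w : seq nat) (t : nat) (o : seq nat) :
    Prop :=
  let c := iter t (step P w) init_config in halted P c /\ outp c = o.

(* Total number of binary digits of the input; 0 counts as one digit. *)
Definition bit_length (w : seq nat) : nat :=
  \sum_(x <- w) (trunc_log 2 x).+1.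

(* A search problem has instances in I, written as sequences of numbers by enc;
   sol x o says that o is a correct answer to x.  It is solvable in polynomial
   time on the instances satisfying D if one program answers all of them. *)
Definition poly_time_solvable_on (I : Type) (enc : I -> seq nat)
    (D : I -> Prop) (sol : I -> seq nat -> Prop) : Prop :=
  exists (P : program) (p : {poly nat}), forall x : I, D x ->
    exists o : seq nat,
      outputs_within P (enc x) (p.[bit_length (enc x)])%R o /\ sol x o.

(** * k-stars *)

(* The star with center [None] and m edges, edge i being replaced by a path of
   length l i: [Some (i, j)] is the vertex at distance j+1 from the center on
   the path replacing edge i. *)
Definition spider_vertex (m : nat) (l : 'I_m -> nat) : Type :=
  option {i : 'I_m & 'I_(l i)}.

Definition spider_adj (m : nat) (l : 'I_m -> nat) : rel (spider_vertex l) :=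
  fun x y =>
    match x, y with
    | None, None => false
    | None, Some v | Some v, None => tagged v == 0 :> nat
    | Some u, Some v =>
        (tag u == tag v) &&
        (((tagged u).+1 == tagged v :> nat) || ((tagged v).+1 == tagged u :> nat))
    end.

Definition is_kstar (k : nat) (T : finType) (e : rel T) : Prop :=
  exists (m : nat) (l : 'I_m -> nat),
    (forall i, 1 <= l i <= k) /\
    exists f : T -> spider_vertex l,
      bijective f /\ forall x y, e x y = spider_adj (f x) (f y).

(** * The firefighter process *)

(* Pairs (v, t) with t <= |V|; [valid] requires t >= 1. *)
Definition strategy (T : finType) : Type := {set T * 'I_#|T|.+1}.

(* The vertices protected at some time t' <= t. *)
Definition protected_by (T : finType) (Phi : strategy T) (t : nat) : {set T} :=
  [set x.1 | x in Phi & x.2 <= t].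

(* The vertices burned at time t.  Spreading takes place at the steps t >= 1 and
   takes effect at time t+1; hence only s is burned at times 0 and 1. *)
Fixpoint burned (T : finType) (e : rel T) (s : T) (Phi : strategy T) (t : nat) :
    {set T} :=
  if t is t'.+1 then
    let B := burned e s Phi t' in
    B :|: [set v | [&& 0 < t', v \notin protected_by Phi t'
                     & [exists u in B, e u v]]]
  else [set s].

Definition valid (T : finType) (e : rel T) (s : T) (b : nat)
    (Phi : strategy T) : Prop :=
  [/\ forall v t, (v, t) \in Phi -> 0 < t,
      forall v t, (v, t) \in Phi -> v \notin burned e s Phi t
    & forall t, #|[set x in Phi | x.2 == t]| <= b].

Definition protected (T : finType) (Phi : strategy T) : {set T} :=
  [set x.1 | x in Phi].

(* The outcome of the whole process; the walk u :: p may be reduced to u. *)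
Definition saved (T : finType) (e : rel T) (s : T) (Phi : strategy T) (v : T) :
    Prop :=
  v \in protected Phi \/
  forall (u : T) (p : seq T), (exists t, u \in burned e s Phi t) ->
    path e u p -> last u p = v -> has (mem (protected Phi)) (u :: p).

Definition nb_saved (T : finType) (e : rel T) (s : T) (S : {set T})
    (Phi : strategy T) : nat :=
  #|[set v in S | `[< saved e s Phi v >]]|.

Definition optimal (T : finType) (e : rel T) (s : T) (S : {set T}) (b : nat)
    (Phi : strategy T) : Prop :=
  valid e s b Phi /\
  forall Psi : strategy T, valid e s b Psi ->
    nb_saved e s S Psi <= nb_saved e s S Phi.

(** * The problem Max b-Save *)

Record instance : Type := Instance {
  nvert : nat;
  adj : rel 'I_nvert;
  adj_sym : symmetric adj;
  adj_irr : irreflexive adj;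
  source : 'I_nvert;
  target : {set 'I_nvert}
}.

(* |V|, s, the adjacency matrix by rows, the characteristic vector of S. *)
Definition encode (x : instance) : seq nat :=
  [:: nvert x; val (source x)]
  ++ [seq nat_of_bool (adj i j)
        | i <- enum 'I_(nvert x), j <- enum 'I_(nvert x)]
  ++ [seq nat_of_bool (i \in target x) | i <- enum 'I_(nvert x)].

(* o lists the elements of Phi as v_1, t_1, v_2, t_2, ... in some order. *)
Definition lists_strategy (n : nat) (o : seq nat) (Phi : strategy 'I_n) : Prop :=
  exists q : seq ('I_n * 'I_#|'I_n|.+1),
    [/\ uniq q, q =i Phi & o = flatten [seq [:: val x.1; val x.2] | x <- q]].

Definition solves_max_save (b : nat) (x : instance) (o : seq nat) : Prop :=
  exists Phi : strategy 'I_(nvert x),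
    optimal (@adj x) (source x) (target x) b Phi /\ lists_strategy o Phi.

(* Main.v *)
Require Import Defs.
From mathcomp Require Import all_boot all_order all_algebra.
From mathcomp Require Import boolp zify.

(* In a k-star a path without repeated vertices has at most 2k edges, so the
   fire makes no progress after time 2k+1 and protections later than time 2k are
   useless.  There remain 2kb slots (a time and one of b places), each empty or
   holding a vertex: (n+1)^(2kb) candidates, a polynomial number since k and b
   are fixed, and exhaustive search is affordable.

   All quantities involved (burned sets, validity, score, number of a best
   candidate) are values of expressions in a small language whose only loop is
   the bounded sum.  Every such expression compiles to the random access machine
   and has polynomially bounded value and running time. *)

Set Implicit Arguments.
Unset Strict Implicit.
Unset Printing Implicit Defensive.

(** * Expressions and their compilation *)

Inductive expr : Type :=
  | Var of nat
  | Cst of nat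
  | Plus of expr & expr
  | Monus of expr & expr
  | Inp of expr
  | Sum of nat & expr & expr.

Fixpoint eval (w : seq nat) (r : nat -> nat) (e : expr) : nat :=
  match e with
  | Var v => r v
  | Cst c => c
  | Plus a b => eval w r a + eval w r b
  | Monus a b => eval w r a - eval w r b
  | Inp a => nth 0 w (eval w r a)
  | Sum v a b => \sum_(i < eval w r a) eval w (upd r v i) b
  end.

(** Loop variables are counted too, so every register from this number on is free as scratch
    space. *)
Fixpoint nvars (e : expr) : nat :=
  match e with
  | Var v => v.+1
  | Cst _ => 0
  | Plus a b | Monus a b => maxn (nvars a) (nvars b)
  | Inp a => nvars a
  | Sum v a b => maxn v.+1 (maxn (nvars a) (nvars b))
  end.

Lemma eval_ext w e r r' :
  (forall j, j < nvars e -> r j = r' j) -> eval w r e = eval w r' e.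
Proof.
elim: e r r' => [v|c|a IHa b IHb|a IHa b IHb|a IHa|v a IHa b IHb] r r' /= H //.
- exact: H.
- by rewrite (IHa r r') ?(IHb r r') // => j Hj; apply: H; lia.
- by rewrite (IHa r r') ?(IHb r r') // => j Hj; apply: H; lia.
- by rewrite (IHa r r').
rewrite (IHa r r') => [|j Hj]; last by apply: H; lia.
apply: eq_bigr => i _; apply: IHb => j Hj.
by rewrite /upd; case: eqP => // _; apply: H; lia.
Qed.

Lemma eval_upd_fresh w e r v i : nvars e <= v -> eval w (upd r v i) e = eval w r e.
Proof.
by move=> H; apply: eval_ext => j Hj; rewrite /upd; case: eqP => //; lia.
Qed.

(* [compile a t e] is to be placed at address a; it leaves the value of e in
   register t and preserves the registers below t, which hold the variables. *)
Fixpoint compile (a t : nat) (e : expr) : program :=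
  match e with
  | Var v => [:: Const t 0; AddReg t t v]
  | Cst c => [:: Const t c]
  | Plus x y =>
      let cx := compile a t x in
      cx ++ compile (a + size cx) t.+1 y ++ [:: AddReg t t t.+1]
  | Monus x y =>
      let cx := compile a t x in
      cx ++ compile (a + size cx) t.+1 y ++ [:: SubReg t t t.+1]
  | Inp x => compile a t x ++ [:: Read t t]
  | Sum v x y =>
      let cx := compile a t x in
      let h := a + size cx + 4 in
      let cy := compile (h + 2) t.+3 y in
      cx ++ [:: Const t.+1 0; Const t.+2 0; AddReg t.+2 t.+2 v; Const v 0]
      ++ [:: SubReg t.+3 t v; JumpZero t.+3 (h + 2 + size cy + 4)]
      ++ cy ++ [:: AddReg t.+1 t.+1 t.+3; Const t.+3 1; AddReg v v t.+3; Jump h]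
      ++ [:: Const v 0; AddReg v v t.+2; Const t 0; AddReg t t t.+1]
  end.

(** Number of executed instructions. For a sum: 4 of set-up, 6 per round besides the body (2 for the
    test, 4 to accumulate, increment and jump back), 2 for the last test, 4 to restore the variable
    and deliver the result. *)
Fixpoint cost (w : seq nat) (r : nat -> nat) (e : expr) : nat :=
  match e with
  | Var _ => 2
  | Cst _ => 1
  | Plus a b | Monus a b => cost w r a + (cost w r b + 1)
  | Inp a => cost w r a + 1
  | Sum v a b =>
      cost w r a + (4 + ((\sum_(i < eval w r a) (cost w (upd r v i) b + 6) + 2) + 4))
  end.

Lemma cost_ext w e r r' :
  (forall j, j < nvars e -> r j = r' j) -> cost w r e = cost w r' e.
Proof.
elim: e r r' => [v|c|a IHa b IHb|a IHa b IHb|a IHa|v a IHa b IHb] r r' /= H //.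
- by rewrite (IHa r r') ?(IHb r r') // => j Hj; apply: H; lia.
- by rewrite (IHa r r') ?(IHb r r') // => j Hj; apply: H; lia.
- by rewrite (IHa r r').
rewrite (IHa r r') ?(@eval_ext _ a r r') => [|j Hj|j Hj]; try by apply: H; lia.
do 3 congr (_ + _); congr (_ + _); apply: eq_bigr => i _; congr (_ + _).
apply: IHb => j Hj.
by rewrite /upd; case: eqP => // _; apply: H; lia.
Qed.

(** * Placed code and runs of the machine *)

Definition code_at (P : program) (a : nat) (C : program) : Prop :=
  forall i, i < size C -> onth P (a + i) = onth C i.

Lemma code_at_cat P a C1 C2 :
  code_at P a (C1 ++ C2) -> code_at P a C1 /\ code_at P (a + size C1) C2.
Proof.
move=> H; split=> i Hi.
  by rewrite H ?size_cat ?onth_cat ?Hi //; lia.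
by rewrite -addnA H ?size_cat ?onth_cat ?ltn_add2l // ltnNge leq_addr /= addKn.
Qed.

Lemma code_at_drop P a d C : code_at P a C -> code_at P (a + d) (drop d C).
Proof.
case: (leqP d (size C)) => Hd; last by rewrite drop_oversize // ltnW.
rewrite -{1}(cat_take_drop d C) => /code_at_cat[_].
by rewrite size_take_min (minn_idPl Hd).
Qed.

Definition reach (P : program) (w : seq nat) (c : config) (T : nat) (c' : config) :=
  exists2 t, t <= T & iter t (step P w) c = c'.

Lemma reach_refl P w c : reach P w c 0 c.
Proof. by exists 0. Qed.

Lemma reach_trans P w c1 c2 c3 T1 T2 :
  reach P w c1 T1 c2 -> reach P w c2 T2 c3 -> reach P w c1 (T1 + T2) c3.
Proof.
case=> t1 H1 E1 [t2 H2 E2]; exists (t2 + t1); first lia.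
by rewrite iterD E1.
Qed.

Lemma reach_leq P w c1 c2 T1 T2 : T1 <= T2 -> reach P w c1 T1 c2 -> reach P w c1 T2 c2.
Proof. by move=> H [t Ht E]; exists t => //; lia. Qed.

Lemma reach_instr P w a i q r o :
  code_at P a (i :: q) ->
  reach P w (Config a r o) 1 (exec_instr w i (Config a r o)) /\ code_at P a.+1 q.
Proof.
rewrite -cat1s => /code_at_cat [H1 H2]; split; last by move: H2; rewrite /= addn1.
exists 1 => //=; have := H1 0 isT; rewrite addn0 /= => E.
(* An equation between [onth] values also says that the address exists in [P], so the machine has
   not halted there. *)
have Hlt : a < size P by rewrite -onthTE E.
by rewrite /step /halted /= leqNgt Hlt (onth_nth _ _ _ _ E).
Qed.

Definition computes (P : program) (w : seq nat) (a t : nat) (C : program)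
    (T v : nat) (r : nat -> nat) : Prop :=
  code_at P a C -> forall o, exists r',
    [/\ reach P w (Config a r o) T (Config (a + size C) r' o), r' t = v
      & forall j, j < t -> r' j = r j].

(** Induction on [e]. The variables lie below [t] and scratch registers are taken from [t] upward,
    so the second operand, evaluated from [t.+1] on, spoils neither the variables nor the first
    result. *)
Lemma compile_correct P w e a t r :
  nvars e <= t -> computes P w a t (compile a t e) (cost w r e) (eval w r e) r.
Proof.
elim: e a t r => [v|c|x IHx y IHy|x IHx y IHy|x IHx|v x IHx y IHy] a t r /= Ht HC o.
- have [R1 H1] := reach_instr w r o HC.
  have [R2 H2] := reach_instr w (upd r t 0) o H1.
  exists (upd (upd r t 0) t (r v)); split.
  + have := reach_trans R1 R2; rewrite /= addn2; congr (reach _ _ _ _ (Config _ _ _)).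
    by rewrite /upd eqxx ltn_eqF.
  + by rewrite /upd eqxx.
  + by move=> j Hj; rewrite /upd ltn_eqF.
- have [R1 _] := reach_instr w r o HC.
  exists (upd r t c); split; rewrite ?addn1 //; first by rewrite /upd eqxx.
  by move=> j Hj; rewrite /upd ltn_eqF.
- have [H1 /code_at_cat[H2 H3]] := code_at_cat HC.
  have [|r1 [R1 E1 K1]] := IHx a t r _ H1 o; first lia.
  have [|r2 [R2 E2 K2]] := IHy _ t.+1 r1 _ H2 o; first lia.
  have [R3 _] := reach_instr w r2 o H3.
  exists (upd r2 t (r2 t + r2 t.+1)); split.
  + have -> : forall i, a + size (compile a t x ++ compile (a + size (compile a t x)) t.+1 y ++ [:: i])
        = (a + size (compile a t x) + size (compile (a + size (compile a t x)) t.+1 y)).+1.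
      by move=> ?; rewrite !size_cat /=; lia.
    rewrite (@cost_ext _ y r1 r) in R2; last by move=> j Hj; apply: K1; lia.
    exact: reach_trans R1 (reach_trans R2 R3).
  + rewrite {1}/upd eqxx K2 // E1 E2; congr (_ + _).
    by apply: eval_ext => j Hj; apply: K1; lia.
  + by move=> j Hj; rewrite /upd ltn_eqF // K2 ?K1 //; lia.
- have [H1 /code_at_cat[H2 H3]] := code_at_cat HC.
  have [|r1 [R1 E1 K1]] := IHx a t r _ H1 o; first lia.
  have [|r2 [R2 E2 K2]] := IHy _ t.+1 r1 _ H2 o; first lia.
  have [R3 _] := reach_instr w r2 o H3.
  exists (upd r2 t (r2 t - r2 t.+1)); split.
  + have -> : forall i, a + size (compile a t x ++ compile (a + size (compile a t x)) t.+1 y ++ [:: i])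
        = (a + size (compile a t x) + size (compile (a + size (compile a t x)) t.+1 y)).+1.
      by move=> ?; rewrite !size_cat /=; lia.
    rewrite (@cost_ext _ y r1 r) in R2; last by move=> j Hj; apply: K1; lia.
    exact: reach_trans R1 (reach_trans R2 R3).
  + rewrite {1}/upd eqxx K2 // E1 E2; congr (_ - _).
    by apply: eval_ext => j Hj; apply: K1; lia.
  + by move=> j Hj; rewrite /upd ltn_eqF // K2 ?K1 //; lia.
- have [H1 H2] := code_at_cat HC.
  have [|r1 [R1 E1 K1]] := IHx a t r _ H1 o; first lia.
  have [R2 _] := reach_instr w r1 o H2.
  exists (upd r1 t (nth 0 w (r1 t))); split.
  + by rewrite size_cat addnA [_ + size [:: _]]addn1; exact: reach_trans R1 R2.
  + by rewrite /upd eqxx E1.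
  + by move=> j Hj; rewrite /upd ltn_eqF // K1.
move: HC; set cx := compile a t x; set h := a + size cx + 4.
set cy := compile (h + 2) t.+3 y; set fin := h + 2 + size cy + 4 => HC.
have [H1 H2] := code_at_cat HC.
have H3 := @code_at_drop _ _ 4 _ H2; rewrite /= -/h in H3.
have H4 := @code_at_drop _ _ 2 _ H3; rewrite /= drop0 in H4.
have {H4} [H4 H5] := code_at_cat H4.
have H6 := @code_at_drop _ _ 4 _ H5; rewrite /= -/fin in H6.
have [|r1 [R1 E1 K1]] := IHx a t r _ H1 o; first lia.
(* Loop invariant at the test: [t] holds the bound, [v] the counter, [t.+1] the partial sum, [t.+2]
   the saved value of [v]. The induction is on the number of rounds left. *)
have loop i acc q : i <= eval w r x -> q t = eval w r x -> q v = i ->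
    q t.+1 = acc -> q t.+2 = r v -> (forall j, j < t -> j != v -> q j = r j) ->
  exists q', [/\ reach P w (Config h q o)
      (\sum_(i <= j < eval w r x) (cost w (upd r v j) y + 6) + 2) (Config fin q' o),
    q' t.+1 = acc + \sum_(i <= j < eval w r x) eval w (upd r v j) y,
    q' t.+2 = r v & forall j, j < t -> j != v -> q' j = r j].
  move=> Hi; move Ed : (eval w r x - i) => d.
  elim: d i Hi Ed acc q => [|d IHd] i Hi Ed acc q Qt Qv Qa Qo Qj.
    have -> : i = eval w r x by lia.
    have [S1 H7] := reach_instr w q o H3.
    have [S2 _] := reach_instr w (upd q t.+3 (q t - q v)) o H7.
    exists (upd q t.+3 (q t - q v)); rewrite !big_geq //; split.
    + have := reach_trans S1 S2; rewrite /=; congr (reach _ _ _ _ (Config _ _ _)).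
      by rewrite /upd eqxx Qt Qv Ed eqxx.
    + by rewrite /upd ltn_eqF // Qa addn0.
    + by rewrite /upd ltn_eqF.
    + by move=> j Hj Hv; rewrite /upd ltn_eqF ?Qj //; lia.
  have [S1 H7] := reach_instr w q o H3.
  have [S2 _] := reach_instr w (upd q t.+3 (q t - q v)) o H7.
  have {S2} S := reach_trans S1 S2.
  rewrite /= in S.
  set q1 := upd q t.+3 (q t - q v) in S.
  have E : (q1 t.+3 == 0) = false by rewrite /q1 /upd eqxx; lia.
  rewrite E -addn2 in S.
  have Q1 j : j < t.+3 -> q1 j = q j by move=> Hj; rewrite /q1 /upd ltn_eqF.
  have [|q2 [S3 F2 K2]] := IHy (h + 2) t.+3 q1 _ H4 o; first lia.
  have X j : j < nvars y -> q1 j = upd r v i j.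
    move=> Hj; rewrite Q1; last lia.
    by rewrite /upd; case: eqP => [->//|/eqP Hv]; apply: Qj => //; lia.
  rewrite (cost_ext w X) in S3; rewrite (eval_ext w X) in F2.
  have [S4 H8] := reach_instr w q2 o H5.
  rewrite /= in S4; set q3 := upd _ _ _ in S4.
  have [S5 H9] := reach_instr w q3 o H8.
  rewrite /= in S5; set q4 := upd _ _ _ in S5.
  have [S6 H10] := reach_instr w q4 o H9.
  rewrite /= in S6; set q5 := upd _ _ _ in S6.
  have [S7 _] := reach_instr w q5 o H10.
  have Hvt : v < t by lia.
  have Q2 j : j < t.+3 -> q2 j = q j by move=> Hj; rewrite K2 // Q1.
  have Q4v : q4 v = i by rewrite /q4 /q3 /upd !ltn_eqF ?Q2 //; lia.
  have Q43 : q4 t.+3 = 1 by rewrite /q4 /upd eqxx.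
  have [| | | | | | |q' [S8 G1 G2 G3]] :=
      IHd i.+1 _ _ (acc + eval w (upd r v i) y) q5; try lia.
  + by rewrite /q5 /q4 /q3 /upd (gtn_eqF Hvt) !ltn_eqF ?Q2 //; lia.
  + by rewrite /q5 {1}/upd eqxx Q4v Q43 addn1.
  + rewrite /q5 /q4 /q3 /upd (@gtn_eqF v t.+1); last lia.
    by rewrite ltn_eqF // eqxx F2 Q2 ?Qa.
  + rewrite /q5 /q4 /q3 /upd (@gtn_eqF v t.+2); last lia.
    by rewrite ltn_eqF // gtn_eqF // Q2.
  + move=> j Hj Hv; rewrite /q5 /q4 /q3 /upd (negbTE Hv) !ltn_eqF ?Q2 ?Qj //; lia.
  exists q'; split => //.
  + rewrite big_ltn; last lia.
    apply: reach_leq (reach_trans S (reach_trans S3 (reach_trans S4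
      (reach_trans S5 (reach_trans S6 (reach_trans S7 S8)))))); lia.
  + rewrite G1 (@big_ltn _ _ _ i) ?addnA //; lia.
have [S1 H7] := reach_instr w r1 o H2.
rewrite /= in S1; set p1 := upd _ _ _ in S1.
have [S2 H8] := reach_instr w p1 o H7.
rewrite /= in S2; set p2 := upd _ _ _ in S2.
have [S3 H9] := reach_instr w p2 o H8.
rewrite /= in S3; set p3 := upd _ _ _ in S3.
have [S4 _] := reach_instr w p3 o H9.
rewrite /= in S4; set p4 := upd _ _ _ in S4.
have Hvt : v < t by lia.
have [| | | | | |q [SL G1 G2 G3]] := loop 0 0 p4.
- by [].
- rewrite /p4 /p3 /p2 /p1 /upd (gtn_eqF Hvt) !ltn_eqF ?E1 //; lia.
- by rewrite /p4 /upd eqxx.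
- rewrite /p4 /p3 /p2 /p1 /upd (@gtn_eqF v t.+1); last lia.
  by rewrite !(@ltn_eqF t.+1 t.+2) // eqxx.
- rewrite /p4 /p3 /p2 /p1 /upd (@gtn_eqF v t.+2) ?eqxx; last lia.
  rewrite !ltn_eqF ?K1 //; lia.
- move=> j Hj Hv.
  rewrite /p4 /p3 /p2 /p1 /upd (negbTE Hv) !ltn_eqF ?K1 //; lia.
have [T1 H10] := reach_instr w q o H6.
rewrite /= in T1; set q1 := upd _ _ _ in T1.
have [T2 H11] := reach_instr w q1 o H10.
rewrite /= in T2; set q2 := upd _ _ _ in T2.
have [T3 H12] := reach_instr w q2 o H11.
rewrite /= in T3; set q3 := upd _ _ _ in T3.
have [T4 _] := reach_instr w q3 o H12.
rewrite /= in T4; set q4 := upd _ _ _ in T4.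
exists q4; split.
- rewrite !big_mkord in SL.
  have -> : a + size (cx ++ [:: Const t.+1 0, Const t.+2 0, AddReg t.+2 t.+2 v,
      Const v 0, SubReg t.+3 t v, JumpZero t.+3 fin
    & cy ++ [:: AddReg t.+1 t.+1 t.+3; Const t.+3 1; AddReg v v t.+3; Jump h;
      Const v 0; AddReg v v t.+2; Const t 0; AddReg t t t.+1]]) = fin.+4.
    by rewrite !(size_cat, size_cat) /= size_cat /= /fin /h; lia.
  have S := reach_trans S1 (reach_trans S2 (reach_trans S3 S4)).
  have T := reach_trans T1 (reach_trans T2 (reach_trans T3 T4)).
  have := reach_trans R1 (reach_trans _ (reach_trans SL T)).
  by apply; rewrite /h addn4; exact: S.
- rewrite /q4 /q3 /q2 /q1 /upd !eqxx (@gtn_eqF v t.+1); last lia.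
  by rewrite !gtn_eqF // G1 add0n big_mkord.
- move=> j Hj; rewrite /q4 /q3 /q2 /q1 /upd !(@ltn_eqF j t) //.
  case: eqP => [->|/eqP Hv]; last exact: G3.
  by rewrite eqxx (@gtn_eqF v t.+2) ?G2 //; lia.
Qed.

Fixpoint compile_outputs (a t : nat) (l : seq (expr * expr)) : program :=
  if l is (c, e) :: l' then
    let cc := compile a t c in
    let ce := compile (a + size cc).+1 t e in
    let q := cc ++ JumpZero t (a + size cc + size ce).+2 :: ce ++ [:: Write t] in
    q ++ compile_outputs (a + size q) t l'
  else [::].

Definition outputs (w : seq nat) (r : nat -> nat) (l : seq (expr * expr)) : seq nat :=
  flatten [seq if eval w r x.1 == 0 then [::] else [:: eval w r x.2] | x <- l].

(** The fixed [r0] gives the meaning of all pairs; the actual [r] changes from pair to pair, but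
    only in scratch registers. *)
Lemma compile_outputs_correct P w t r0 l a r o :
    all (fun x => maxn (nvars x.1) (nvars x.2) <= t) l ->
    (forall j, j < t -> r j = r0 j) -> code_at P a (compile_outputs a t l) ->
  exists r', reach P w (Config a r o)
      (\sum_(x <- l) (cost w r0 x.1 + cost w r0 x.2 + 2))
      (Config (a + size (compile_outputs a t l)) r' (o ++ outputs w r0 l)).
Proof.
elim: l a r o => [|[c e] l IH] a r o /= Hl Hr.
  move=> _; exists r; rewrite addn0 /outputs /= cats0 big_nil; exact: reach_refl.
have /andP[Hce {}Hl] := Hl.
set cc := compile a t c; set ce := compile _ t e => /code_at_cat[].
set q := cc ++ _; set tl := compile_outputs _ t l => /code_at_cat[H1 H2] H3.
have [|r1 [R1 E1 K1]] := @compile_correct P w c a t r _ H1 o; first lia.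
have [R2 {}H2] := reach_instr w r1 o H2.
have [H4 H5] := code_at_cat H2.
have X j : j < t -> r1 j = r0 j by move=> Hj; rewrite K1 ?Hr.
rewrite (@cost_ext _ c r r0) in R1; last by move=> j Hj; apply: Hr; lia.
have Ec : eval w r c = eval w r0 c by apply: eval_ext => j Hj; apply: Hr; lia.
rewrite /outputs /= big_cons -/(outputs w r0 l).
have -> : a + size (q ++ tl) = a + size q + size tl by rewrite size_cat addnA.
have Eq : a + size q = (a + size cc + size ce).+2 by rewrite /q !(size_cat, size_cat) /= size_cat /=; lia.
rewrite /= E1 Ec in R2; case: ifP R2 => Hc R2.
  rewrite -Eq in R2.
  have [r' R3] := IH _ r1 o Hl X H3.
  by exists r'; apply: reach_leq (reach_trans R1 (reach_trans R2 R3)); rewrite /=; lia.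
have [|r2 [R3 E2 K2]] := @compile_correct P w e _ t r1 _ H4 o; first lia.
have [R4 _] := reach_instr w r2 o H5.
rewrite (@cost_ext _ e r1 r0) in R3; last by move=> j Hj; apply: X; lia.
have Ee : eval w r1 e = eval w r0 e by apply: eval_ext => j Hj; apply: X; lia.
rewrite /= E2 Ee addSn -Eq in R4.
have [|r' R5] := IH _ r2 (rcons o (eval w r0 e)) Hl _ H3.
  by move=> j Hj; rewrite K2 ?X.
exists r'; rewrite -cat1s catA cats1.
by apply: reach_leq (reach_trans R1 (reach_trans R2 (reach_trans R3
  (reach_trans R4 R5)))); rewrite /=; lia.
Qed.

(** * Polynomial bounds *)

(** The base is at least 2, so constants and sums are absorbed by raising the exponent. One common
    bound [B] on input entries and registers makes the notion stable under nesting of loops. *)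
Definition poly_bounded (f : seq nat -> (nat -> nat) -> nat) : Prop :=
  exists d, forall w r B, (forall i, nth 0 w i <= B) -> (forall i, r i <= B) ->
    f w r <= (B + 2) ^ d.

Lemma poly_boundedD f g : poly_bounded f -> poly_bounded g ->
  poly_bounded (fun w r => f w r + g w r).
Proof.
case=> d1 H1 [d2 H2]; exists (maxn d1 d2).+1 => w r B Hw Hr.
have H3 : (B + 2) ^ d1 <= (B + 2) ^ maxn d1 d2 by apply: leq_pexp2l; lia.
have H4 : (B + 2) ^ d2 <= (B + 2) ^ maxn d1 d2 by apply: leq_pexp2l; lia.
have := H1 w r B Hw Hr; have := H2 w r B Hw Hr; rewrite expnS; nia.
Qed.

Lemma leq_exp2r_le m n d : m <= n -> m ^ d <= n ^ d.
Proof. by case: d => // d H; rewrite leq_exp2r. Qed.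

Lemma poly_boundedC c : poly_bounded (fun _ _ => c).
Proof.
exists c => w r B _ _; apply: (@leq_trans (2 ^ c)); first exact/ltnW/ltn_expl.
by apply: leq_exp2r_le; rewrite addnC.
Qed.

Lemma poly_bounded_leq f g : (forall w r, f w r <= g w r) ->
  poly_bounded g -> poly_bounded f.
Proof. by move=> H [d Hd]; exists d => w r B Hw Hr; apply: leq_trans (H w r) (Hd _ _ _ _ _). Qed.

(** Inside the loop the counter stays below [(B + 2) ^ d1], so [B' = (B + 2) ^ d1.+1] bounds all
    registers there, and [B' + 2 <= (B + 2) ^ d1.+2]. The body thus contributes the exponent
    [d1.+2 * d2], the number of rounds [d1]. *)
Lemma poly_bounded_sum v f g : poly_bounded f -> poly_bounded g ->
  poly_bounded (fun w r => \sum_(i < f w r) g w (upd r v i)).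
Proof.
case=> d1 H1 [d2 H2]; exists (d1 + d1.+1.+1 * d2) => w r B Hw Hr.
have H3 := H1 w r B Hw Hr.
have H4 (i : 'I_(f w r)) : g w (upd r v i) <= (B + 2) ^ (d1.+1.+1 * d2).
  have Hi := ltn_ord i.
  have P1 : 0 < (B + 2) ^ d1 by rewrite expn_gt0 addnS.
  have P2 : B + 2 <= (B + 2) ^ d1.+1 by rewrite expnS; nia.
  apply: leq_trans (H2 w _ ((B + 2) ^ d1.+1) _ _) _.
  - by move=> j; have := Hw j; lia.
  - move=> j; rewrite /upd; case: eqP => _; last by have := Hr j; lia.
    by rewrite expnS; nia.
  - rewrite expnM; apply: leq_exp2r_le; rewrite (expnS _ d1.+1); nia.
apply: (@leq_trans (\sum_(i < f w r) (B + 2) ^ (d1.+1.+1 * d2))).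
  by apply: leq_sum => i _; apply: H4.
by rewrite sum_nat_const card_ord expnD leq_mul2r H3 orbT.
Qed.

(** Values have to be bounded together with costs, because the number of rounds of a loop is a
    value. *)
Lemma poly_bounded_eval_cost e :
  poly_bounded (fun w r => eval w r e) /\ poly_bounded (fun w r => cost w r e).
Proof.
elim: e => [v|c|a [Ea Ca] b [Eb Cb]|a [Ea Ca] b [Eb Cb]|a [Ea Ca]|v a [Ea Ca] b [Eb Cb]] /=.
- split; last exact: poly_boundedC.
  by exists 1 => w r B _ Hr; have := Hr v; rewrite expn1; lia.
- by split; exact: poly_boundedC.
- split; first exact: poly_boundedD.
  by apply: poly_boundedD => //; apply: poly_boundedD => //; exact: poly_boundedC.
- split; first by apply: poly_bounded_leq Ea => w r; exact: leq_subr.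
  by apply: poly_boundedD => //; apply: poly_boundedD => //; exact: poly_boundedC.
- split; last by apply: poly_boundedD => //; exact: poly_boundedC.
  by exists 1 => w r B Hw _; have := Hw (eval w r a); rewrite expn1; lia.
split; first exact: (poly_bounded_sum v Ea Eb).
apply: poly_boundedD => //; apply: poly_boundedD; first exact: poly_boundedC.
apply: poly_boundedD; last exact: poly_boundedC.
apply: poly_boundedD; last exact: poly_boundedC.
apply: (@poly_bounded_sum v (fun w r => eval w r a) (fun w r => cost w r b + 6)) => //.
by apply: poly_boundedD => //; exact: poly_boundedC.
Qed.

Lemma horner_X2_exp d x : (('X + 2%:P) ^+ d : {poly nat}).[x]%R = (x + 2) ^ d.
Proof.
rewrite horner_exp hornerD hornerX hornerC.
by elim: d => // d IH; rewrite GRing.exprS IH expnS.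
Qed.

(** The bit length plays the part of [B], which is why it must dominate every input entry; registers
    start at 0. The time bound is then the polynomial [(X + 2) ^ d]. *)
Lemma outputs_poly_time (I : Type) (enc : I -> seq nat) (D : I -> Prop)
    (sol : I -> seq nat -> Prop) (l : seq (expr * expr)) :
    (forall x i, nth 0 (enc x) i <= bit_length (enc x)) ->
    (forall x, D x -> sol x (outputs (enc x) (fun=> 0) l)) ->
  poly_time_solvable_on enc D sol.
Proof.
move=> Henc Hsol.
pose t := \max_(x <- l) maxn (nvars x.1) (nvars x.2).
have [d Hd] : poly_bounded (fun w r => \sum_(x <- l) (cost w r x.1 + cost w r x.2 + 2)).
  elim: {Hsol t} l => [|x l IH].
    by exists 0 => w r B _ _; rewrite big_nil.
  apply: (@poly_bounded_leq _ (fun w r => (cost w r x.1 + cost w r x.2 + 2) + _)) => [w r|].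
    by rewrite big_cons; exact: leqnn.
  apply: poly_boundedD => //; apply: poly_boundedD; last exact: poly_boundedC.
  by apply: poly_boundedD; exact: (poly_bounded_eval_cost _).2.
exists (compile_outputs 0 t l), (('X + 2%:P) ^+ d)%R => x Dx.
exists (outputs (enc x) (fun=> 0) l); split; last exact: Hsol.
have [|||r' [n Hn E]] :=
  @compile_outputs_correct (compile_outputs 0 t l) (enc x) t (fun=> 0) l 0 (fun=> 0) [::].
- rewrite {}/t; elim: {Hsol Hd} l => //= y l IH; rewrite big_cons leq_maxl /=.
  by apply: sub_all IH => z Hz; rewrite (leq_trans Hz) ?leq_maxr.
- by [].
- by move=> i _; rewrite add0n.
rewrite add0n in E.
rewrite /outputs_within horner_X2_exp.
set T := (_ ^ d).
have {Hn} Hn : n <= T by apply: leq_trans Hn _; apply: Hd.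
rewrite -(subnK Hn) iterD [iter n _ _]E.
(* The run has reached the end of the program, and a halted configuration is a fixed point, so
   waiting until time [T] changes nothing. *)
have -> m : iter m (step (compile_outputs 0 t l) (enc x))
    (Config (size (compile_outputs 0 t l)) r' (outputs (enc x) (fun=> 0) l)) =
    Config (size (compile_outputs 0 t l)) r' (outputs (enc x) (fun=> 0) l).
  by elim: m => //= m ->; rewrite /step /halted /= leqnn.
by split=> //; rewrite /halted /=.
Qed.

(** * The fire on a k-star *)

Section Fire.
Variables (T : finType) (e : rel T) (s : T).
Implicit Types (Phi Psi : strategy T) (S : {set T}).

Lemma burned_mono Phi t1 t2 : t1 <= t2 -> burned e s Phi t1 \subset burned e s Phi t2.
Proof.
move=> /subnK <-; elim: (t2 - t1) => [|d IH]; first exact: subxx.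
by rewrite addSn /=; apply: subset_trans IH _; exact: subsetUl.
Qed.

Lemma in_burnedS Phi t v : (v \in burned e s Phi t.+1) = (v \in burned e s Phi t)
  || [&& 0 < t, v \notin protected_by Phi t & [exists u in burned e s Phi t, e u v]].
Proof. by rewrite /= !inE. Qed.

Lemma protected_by_mono Phi t1 t2 : t1 <= t2 ->
  protected_by Phi t1 \subset protected_by Phi t2.
Proof.
move=> H; apply/subsetP => v /imsetP[y]; rewrite inE => /andP[Hy Ht] ->.
by apply: imset_f; rewrite inE Hy (leq_trans Ht).
Qed.

Lemma protected_byP Phi t v :
  reflect (exists2 y, y \in Phi & y.1 = v /\ y.2 <= t) (v \in protected_by Phi t).
Proof.
apply: (iffP imsetP) => [[y]|[y Hy [E Ht]]].
  by rewrite inE => /andP[Hy Ht] ->; exists y.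
by exists y; rewrite ?inE ?Hy.
Qed.

(** Under a valid strategy a protected vertex never burns. Conversely, fire runs along any walk
    without protected vertices, so such a walk from a burned vertex to [v] would burn [v]. *)
Lemma saved_valid b Phi v : valid e s b Phi ->
  saved e s Phi v <-> (forall t, v \notin burned e s Phi t).
Proof.
case=> _ H2 _.
have not_burned u : u \in protected Phi -> forall t, u \notin burned e s Phi t.
  case/imsetP => -[u' t0] Hy -> /= {u} t.
  have H0 := H2 _ _ Hy.
  elim: t => [|t IH]; first exact: contra (subsetP (burned_mono _ (leq0n _)) _) H0.
  case: (leqP t.+1 t0) => Ht; first exact: contra (subsetP (burned_mono _ Ht) _) H0.
  have Hp : u' \in protected_by Phi t by apply/protected_byP; exists (u', t0).
  by rewrite in_burnedS negb_or IH Hp /= andbF.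
split=> [[Hv|Hv] t|Hv].
- exact: not_burned.
- apply/negP => Hb.
  have := Hv v [::] (ex_intro _ t Hb) isT erefl; rewrite /= orbF => /not_burned/(_ t).
  by rewrite Hb.
right=> u p Hu Hp Ev; apply/negP => /negP Hn.
elim: p u Hu Hp Ev Hn => [|a p IH] u [t Hu] /=.
  by move=> _ Ev; move: Hu; rewrite Ev (negbTE (Hv t)).
move=> /andP[Hua Hp] Ev; rewrite negb_or => /andP[_ Hn].
(* The time [t] may be 0, when nothing spreads yet; so the fire is passed on at [t.+1] and arrives
   at [t.+2]. *)
apply: (IH a _ Hp Ev Hn); exists t.+2.
have Hut : u \in burned e s Phi t.+1 by apply: (subsetP (burned_mono _ (leqnSn t))).
have Ha : a \notin protected_by Phi t.+1.
  apply: contra Hn => /protected_byP[y Hy [<- _]].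
  by apply/orP; left; apply: imset_f.
rewrite in_burnedS Ha; apply/orP; right.
by apply/existsP; exists u; rewrite Hut.
Qed.

(** A newly burned vertex was ignited by a neighbour that was itself new one step earlier. Tracing
    back to [s] gives the path; it has no repetition because each vertex was still unburned when its
    predecessors burned. *)
Lemma new_burned_path Phi t v :
    v \in burned e s Phi t.+1 -> v \notin burned e s Phi t ->
  exists p, [/\ path e s p, uniq (s :: p), size p = t, last s p = v
              & {subset s :: p <= burned e s Phi t.+1}].
Proof.
elim: t v => [|t IH] v; first by rewrite /= !inE /= orbF => ->.
rewrite in_burnedS => /orP[->//|/and3P[_ Hp /existsP[u /andP[Hu Huv]]]] Hv.
have Hs : s \in burned e s Phi t.+1.
  by apply: (subsetP (burned_mono Phi (leq0n _))); rewrite /= inE.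
have Hvs : v != s by apply: contraNneq Hv => ->.
have Hnew : v \in burned e s Phi t.+2.
  rewrite in_burnedS Hp.
  by apply/orP; right; apply/existsP; exists u; rewrite Hu.
have [Hut|Hut] := boolP (u \in burned e s Phi t).
  (* An older burned neighbour is possible only at the start, where [u = s] because step 0 spreads
     nothing; later on it would have ignited [v] one step sooner. *)
  case: t {IH} Hv Hp Hs Hut Hnew Hu => [|t] Hv Hp Hs Hut Hnew Hu.
    rewrite inE in Hut; rewrite (eqP Hut) in Huv.
    exists [:: v]; split=> // [||z]; first by rewrite /= Huv.
      by rewrite cons_uniq mem_seq1 eq_sym Hvs.
    rewrite inE => /orP[/eqP->|]; last by rewrite mem_seq1 => /eqP->.
    by rewrite in_burnedS Hs.
  case/negP: Hv; rewrite in_burnedS.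
  apply/orP; right; apply/and3P; split=> //.
    exact: contra (subsetP (protected_by_mono Phi (leqnSn _)) _) Hp.
  by apply/existsP; exists u; rewrite Hut.
have [p [P1 P2 P3 P4 P5]] := IH u Hu Hut.
exists (rcons p v); split.
- by rewrite rcons_path P1 P4.
- by rewrite -rcons_cons rcons_uniq P2 andbT; apply: contra Hv => /P5.
- by rewrite size_rcons P3.
- by rewrite last_rcons.
move=> z; rewrite -rcons_cons mem_rcons inE => /orP[/eqP->//|/P5 Hz].
exact: (subsetP (burned_mono Phi (leqnSn _))).
Qed.

(** A vertex first burned after time [D.+1] would end a repetition-free path with more than [D]
    edges. *)
Lemma burned_stable D Phi t :
    (forall p, path e s p -> uniq (s :: p) -> size p <= D) ->
  burned e s Phi t \subset burned e s Phi D.+1.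
Proof.
move=> HD; elim: t => [|t IH]; first exact: burned_mono.
case: (leqP t D) => Ht; first exact: burned_mono.
apply/subsetP => v Hv; have [/(subsetP IH)//|Hn] := boolP (v \in burned e s Phi t).
have [p [P1 P2 P3 _ _]] := new_burned_path Hv Hn.
by have := HD p P1 P2; rewrite P3 leqNgt Ht.
Qed.

Definition truncate Phi D : strategy T := [set y in Phi | y.2 <= D].

(** The set burned at [t.+1] depends only on protections up to time [t]; hence the bound [D.+1]. *)
Lemma burned_truncate Phi D t : t <= D.+1 ->
  burned e s (truncate Phi D) t = burned e s Phi t.
Proof.
elim: t => //= t IH; rewrite ltnS => Ht; rewrite IH; last lia.
suff -> : protected_by (truncate Phi D) t = protected_by Phi t by [].
apply/setP => v; apply/protected_byP/protected_byP => -[y Hy [Ev Hyt]]; exists y => //.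
  by move: Hy; rewrite inE => /andP[].
by rewrite inE Hy (leq_trans Hyt).
Qed.

Lemma valid_truncate b Phi D : valid e s b Phi -> valid e s b (truncate Phi D).
Proof.
case=> H1 H2 H3; split=> [v t|v t|t].
- by rewrite inE => /andP[/H1].
- rewrite inE /= => /andP[Hv Ht]; rewrite burned_truncate; last lia.
  exact: H2.
- apply: leq_trans (H3 t); apply: subset_leq_card; apply/subsetP => y.
  by rewrite !inE => /andP[/andP[-> _] ->].
Qed.

Lemma nb_saved_valid b S Phi D :
    (forall p, path e s p -> uniq (s :: p) -> size p <= D) -> valid e s b Phi ->
  nb_saved e s S Phi = #|S :\: burned e s Phi D.+1|.
Proof.
move=> HD HPhi; apply: eq_card => v; rewrite in_set in_setD andbC; congr (_ && _).
have [H1 H2] := saved_valid v HPhi.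
apply/asboolP/idP => [/H1/(_ D.+1)//|Hv]; apply: H2 => t; apply: contra Hv.
exact: (subsetP (burned_stable _ _ HD)).
Qed.

(** Truncating a competitor at [D] keeps it valid and leaves its final burned set unchanged, so
    comparing with early strategies suffices. *)
Lemma optimalP b S Phi D :
    (forall p, path e s p -> uniq (s :: p) -> size p <= D) -> valid e s b Phi ->
    (forall Psi, valid e s b Psi -> (forall y, y \in Psi -> y.2 <= D) ->
      #|S :\: burned e s Psi D.+1| <= #|S :\: burned e s Phi D.+1|) ->
  optimal e s S b Phi.
Proof.
move=> HD HPhi Hmax; split=> // Psi HPsi.
rewrite (nb_saved_valid S HD HPsi) (nb_saved_valid S HD HPhi).
rewrite -(burned_truncate Psi (leqnn D.+1)).
apply: Hmax; first exact: valid_truncate.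
by move=> y; rewrite inE => /andP[].
Qed.

End Fire.

(** * Length of paths in a k-star *)

Lemma spider_branch_size m (l : 'I_m -> nat) k (q : seq (spider_vertex l)) :
    (forall i, l i <= k) -> sorted (@spider_adj m l) q -> None \notin q -> uniq q ->
  size q <= k.
Proof.
move=> Hl; case: q => // -[[i j]|] q; last by rewrite inE.
move=> Hq Hn Hu; apply: leq_trans (Hl i).
rewrite -[l i]size_enum_ord -(size_map (fun j => Some (Tagged (fun i => 'I_(l i)) j))).
apply: uniq_leq_size => // y Hy.
(* Adjacent vertices other than the center share their branch index, so the whole walk stays on
   branch [i], which has [l i] vertices. *)
suff: exists j' : 'I_(l i), y = Some (Tagged (fun i => 'I_(l i)) j').
  by case=> j' ->; apply: map_f; rewrite mem_enum.
move: Hy Hq Hn; rewrite /=; elim: q {Hu} j => [|[[i' j']|] q IH] j.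
- by rewrite inE => /eqP-> _ _; exists j.
- rewrite inE => /orP[/eqP-> _ _|Hy]; first by exists j.
  rewrite /= => /andP[/andP[/= /eqP Ei _] Hq] Hn; subst i'.
  by apply: (IH j') => //; move: Hn; rewrite !inE.
- by rewrite !inE orbT.
Qed.

(** The center occurs at most once; the parts before and after it each lie on one branch and have at
    most [k] vertices, which gives at most [2k + 1] vertices. *)
Lemma kstar_path_size k (T : finType) (e : rel T) s p :
  is_kstar k e -> path e s p -> uniq (s :: p) -> size p <= k.*2.
Proof.
case=> m [l [Hl [f [Hf Hadj]]]] Hp Hu.
have Hlk i : l i <= k by case/andP: (Hl i).
have Hs : sorted (@spider_adj m l) (map f (s :: p)).
  by rewrite sorted_map (eq_sorted (e' := e)) // => x y; rewrite /= Hadj.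
have {}Hu : uniq (map f (s :: p)) by rewrite map_inj_uniq //; exact: bij_inj.
suff: size (map f (s :: p)) <= k.*2.+1 by rewrite size_map.
case: (boolP (None \in map f (s :: p))) => Hn; last first.
  by have := spider_branch_size Hlk Hs Hn Hu; rewrite -addnn; lia.
case/splitPr: Hn Hs Hu => q1 q2.
rewrite cat_uniq /= => Hs /and3P[U1 /norP[N1 _] /andP[N2 U2]].
have B1 : size q1 <= k.
  apply: (spider_branch_size Hlk) => //; move: Hs.
  by case/cat_sorted2.
have B2 : size q2 <= k.
  apply: (spider_branch_size Hlk) => //; move: Hs; rewrite sorted_cat_cons => /andP[_ /path_sorted]; exact.
by rewrite size_cat /= addnS ltnS -addnn leq_add.
Qed.

(** * Derived expressions *)

(** Truth values are numbers, nonzero meaning true. [Not] yields 0 or 1, so a double [Not]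
    normalizes. *)
Definition Not a := Monus (Cst 1) a.
Definition Or a c := Not (Not (Plus a c)).
Definition And a c := Not (Plus (Not a) (Not c)).
Definition Leq a c := Not (Monus a c).
Definition Eq a c := Not (Plus (Monus a c) (Monus c a)).
Definition Ex v a e := Not (Not (Sum v a e)).
Definition Ors (l : seq expr) := foldr Or (Cst 0) l.
Definition Mul a c := Sum (nvars c) a c.
Definition Pow a m := iter m (Mul a) (Cst 1).
(** For positive [c] the quotient is the number of [i < a] with [(i + 1) * c <= a]. *)
Definition Div a c :=
  let v := maxn (nvars a) (nvars c) in Sum v a (Leq (Mul (Plus (Var v) (Cst 1)) c) a).
Definition Mod a c := Monus a (Mul (Div a c) c).

Section EvalDerived.
Variable w : seq nat.
Implicit Types (r : nat -> nat) (a c e : expr).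

Lemma bool_neq0 (p : bool) : ((p : nat) != 0) = p.
Proof. by case: p. Qed.

Lemma eval_Not r a : eval w r (Not a) = (eval w r a == 0).
Proof. by rewrite /=; case: eqP; lia. Qed.

Lemma eval_Plus r a c : eval w r (Plus a c) = eval w r a + eval w r c.
Proof. by []. Qed.

Lemma eval_Monus r a c : eval w r (Monus a c) = eval w r a - eval w r c.
Proof. by []. Qed.

Lemma eval_Inp r a : eval w r (Inp a) = nth 0 w (eval w r a).
Proof. by []. Qed.

Lemma eval_Sum r v a c :
  eval w r (Sum v a c) = \sum_(i < eval w r a) eval w (upd r v i) c.
Proof. by []. Qed.

Lemma eval_Or r a c : eval w r (Or a c) = (eval w r a != 0) || (eval w r c != 0).
Proof. by rewrite !eval_Not eqb0 eval_Plus addn_eq0 negb_and. Qed.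

Lemma eval_And r a c : eval w r (And a c) = (eval w r a != 0) && (eval w r c != 0).
Proof. by rewrite eval_Not eval_Plus addn_eq0 !eval_Not !eqb0. Qed.

Lemma eval_Leq r a c : eval w r (Leq a c) = (eval w r a <= eval w r c).
Proof. by rewrite eval_Not. Qed.

Lemma eval_Eq r a c : eval w r (Eq a c) = (eval w r a == eval w r c).
Proof. by rewrite eval_Not /= addn_eq0 !subn_eq0 eqn_leq. Qed.

Lemma eval_Ex r v a e :
  eval w r (Ex v a e) = [exists i : 'I_(eval w r a), eval w (upd r v i) e != 0].
Proof.
rewrite !eval_Not eqb0 eval_Sum sum_nat_eq0 negb_forall.
by congr nat_of_bool; apply: eq_existsb => i; rewrite implyTb.
Qed.

Lemma eval_Ors r (I : Type) (f : I -> expr) l :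
  eval w r (Ors (map f l)) = has (fun i => eval w r (f i) != 0) l.
Proof.
elim: l => // i l IH.
by rewrite [Ors _]/= eval_Or -/(Ors _) IH bool_neq0.
Qed.

Lemma eval_Mul r a c : eval w r (Mul a c) = eval w r a * eval w r c.
Proof.
rewrite /= (eq_bigr (fun=> eval w r c)) => [|i _]; last exact: eval_upd_fresh.
by rewrite sum_nat_const card_ord.
Qed.

Lemma eval_Pow r a m : eval w r (Pow a m) = eval w r a ^ m.
Proof. by elim: m => // m IH; rewrite [Pow _ _]/= eval_Mul IH expnS. Qed.

Lemma sum_ltn m k : \sum_(i < m) (i < k : nat) = minn m k.
Proof.
elim: m => [|m IH]; first by rewrite big_ord0 min0n.
by rewrite big_ord_recr /= IH; case: ltnP; lia.
Qed.

Lemma eval_Div r a c : 0 < eval w r c ->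
  eval w r (Div a c) = eval w r a %/ eval w r c.
Proof.
move=> Hc; rewrite /Div; set v := maxn _ _.
have Ha : nvars a <= v by rewrite leq_maxl.
have Hv : nvars c <= v by rewrite leq_maxr.
rewrite eval_Sum; transitivity (\sum_(i < eval w r a) (i < eval w r a %/ eval w r c : nat)).
  apply: eq_bigr => i _; rewrite eval_Leq eval_Mul eval_Plus !(@eval_upd_fresh w c, @eval_upd_fresh w a) //.
  by rewrite /= /upd eqxx addn1 leq_divRL.
by rewrite sum_ltn; apply/minn_idPr; exact: leq_div.
Qed.

Lemma eval_Mod r a c : 0 < eval w r c ->
  eval w r (Mod a c) = eval w r a %% eval w r c.
Proof.
move=> Hc; rewrite /Mod eval_Monus eval_Mul eval_Div //.
by rewrite {1}(divn_eq (eval w r a) (eval w r c)) addKn.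
Qed.

Lemma outputs_pairs r (I : Type) (p f g : I -> expr) l :
  outputs w r (flatten [seq [:: (p i, f i); (p i, g i)] | i <- l]) =
  flatten [seq [:: eval w r (f i); eval w r (g i)] | i <- l & eval w r (p i) != 0].
Proof.
elim: l => // i l; rewrite /outputs /=.
by case: (eval w r (p i) == 0) => /= ->.
Qed.

End EvalDerived.

(* The sum counts the numbers below the least solution. *)
Lemma sum_least m (p : pred nat) N : N < m -> p N ->
  let M := \sum_(i < m) ~~ [exists j : 'I_i.+1, p j] in M < m /\ p M.
Proof.
move=> HN pN /=.
have ex : exists N, p N by exists N.
case: (ex_minnP ex) => M pM HM.
have HMm : M < m by have := HM N pN; lia.
suff -> : \sum_(i < m) ~~ [exists j : 'I_i.+1, p j] = M by [].
transitivity (\sum_(i < m) (i < M : nat)); last by rewrite sum_ltn; lia.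
apply: eq_bigr => i _; congr nat_of_bool; rewrite ltnNge; congr negb.
apply/existsP/idP => [[j /HM Hj]|Hi]; first by have := ltn_ord j; lia.
by exists (Ordinal (Hi : M < i.+1)).
Qed.

Lemma digits_exist B m (x : nat -> nat) : (forall i, x i < B) ->
  exists2 N, N < B ^ m & forall i, i < m -> N %/ B ^ i %% B = x i.
Proof.
elim: m x => [|m IH] x Hx; first by exists 0.
have [N HN E] := IH (fun i => x i.+1) (fun i => Hx i.+1).
have HB : 0 < B by have := Hx 0; lia.
exists (N * B + x 0); first by have := Hx 0; rewrite expnS; nia.
case=> [_|i Hi]; first by rewrite divn1 modnMDl modn_small.
by rewrite expnS divnMA divnMDl // (divn_small (Hx 0)) addn0 E.
Qed.

Lemma nth_allpairs (A B : Type) (f : A -> B -> nat) s t x0 y0 i j :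
    i < size s -> j < size t ->
  nth 0 [seq f x y | x <- s, y <- t] (i * size t + j) = f (nth x0 s i) (nth y0 t j).
Proof.
elim: s i => // x s IH [|i] /= Hi Hj; rewrite nth_cat size_map.
  by rewrite add0n Hj (nth_map y0).
by rewrite mulSn -addnA ltnNge leq_addr /= addKn IH.
Qed.

(** * Entries of the encoded instance *)

Section Encoding.
Variable x : instance.
Let n := nvert x.
Let w := encode x.

Lemma encode_nvert : nth 0 w 0 = n. Proof. by []. Qed.
Lemma encode_source : nth 0 w 1 = source x. Proof. by []. Qed.

Lemma encode_adj (i j : 'I_n) : nth 0 w (2 + (i * n + j)) = adj i j.
Proof.
rewrite /w /encode add2n /= nth_cat size_allpairs size_enum_ord -/n.
have Hij : i * n + j < n * n by have := ltn_ord i; have := ltn_ord j; nia.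
rewrite Hij; have := @nth_allpairs _ _ (fun i j : 'I_n => adj i j) (enum 'I_n) (enum 'I_n) i j i j.
by rewrite size_enum_ord !nth_ord_enum; apply.
Qed.

Lemma encode_target (i : 'I_n) : nth 0 w (2 + (n * n + i)) = (i \in target x).
Proof.
rewrite /w /encode add2n /= nth_cat size_allpairs size_enum_ord -/n.
rewrite ltnNge leq_addr /= addKn (nth_map i) ?size_enum_ord //.
by rewrite nth_ord_enum.
Qed.

(** No entry exceeds [n.+1], while there are at least [n.+2] entries and each has at least one
    digit. *)
Lemma encode_leq_bit_length i : nth 0 w i <= bit_length w.
Proof.
have Hsize : size w <= bit_length w.
  rewrite /bit_length -sum1_size; exact: leq_sum.
have Hn : n.+2 <= size w.
  by rewrite /w /encode /= size_cat size_allpairs size_map size_enum_ord; lia.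
have Hall : all (leq^~ n.+1) w.
  rewrite /w /encode /= all_cat leqnSn (leqW (ltnW (ltn_ord _))) /=.
  apply/andP; split.
    by apply/allP => _ /allpairsP[y [_ _ ->]]; case: (adj _ _).
  by apply/allP => _ /mapP[y _ ->]; case: (_ \in _).
apply: leq_trans (leq_trans Hn Hsize).
case: (ltnP i (size w)) => Hi; last by rewrite nth_default.
exact: leqW (allP Hall _ (mem_nth 0 Hi)).
Qed.

End Encoding.

(** * Exhaustive search *)

Section Candidates.
Variables (b D n : nat).
Implicit Types (N i : nat).

Definition digit N i := N %/ n.+1 ^ i %% n.+1.
(** Slots come in blocks of [b], one block per time; the successor is there because protection
    starts at time 1. *)
Definition slot_time i := (i %/ b).+1.
Definition slots := iota 0 (D * b).

(* Slot i protects the vertex given by the i-th digit of N in base n+1, at time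
   [slot_time i]; the digit n stands for an empty slot. *)
Definition strategy_of N : strategy 'I_n :=
  [set y : 'I_n * 'I_#|'I_n|.+1 | has (fun i => (digit N i == y.1) && (slot_time i == y.2)) slots].

Lemma strategy_of_time N y : y \in strategy_of N -> 0 < y.2 <= D.
Proof.
rewrite inE => /hasP[i]; rewrite mem_iota add0n => /andP[_ Hi] /andP[_ /eqP<-] /=.
by rewrite /slot_time ltn_divLR //; lia.
Qed.

(** All pairs at time [t] come from the [b] slots of one block. The vertex [s] is only the default
    of [insubd] for the digit [n] of an empty slot. *)
Lemma strategy_of_budget (s : 'I_n) N t :
  #|[set x in strategy_of N | x.2 == t]| <= b.
Proof.
pose g (j : 'I_b) := (insubd s (digit N (t.-1 * b + j)), t).
apply: leq_trans (_ : #|g @: 'I_b| <= b); last first.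
  by rewrite -[X in _ <= X](card_ord b) leq_imset_card.
apply: subset_leq_card; apply/subsetP => -[v t']; rewrite !inE /=.
case/andP=> /hasP[i Hi /andP[/eqP Ev /eqP Et]] /eqP E; subst t'.
move: Hi; rewrite mem_iota add0n /= => Hi.
have Hb : 0 < b by lia.
apply/imsetP; exists (Ordinal (ltn_pmod i Hb)) => //.
by rewrite /g /= -Et /slot_time /= -divn_eq Ev valKd.
Qed.

(** The pairs of [Psi] at a given time are listed by [L]; by the budget they fit into the block of
    that time, and the default [n] of [nth] leaves the other slots empty. *)
Lemma strategy_of_surj (Psi : strategy 'I_n) : 0 < b ->
    (forall v t, (v, t) \in Psi -> 0 < t) ->
    (forall t, #|[set x in Psi | x.2 == t]| <= b) ->
    (forall y, y \in Psi -> y.2 <= D) ->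
  exists2 N, N < n.+1 ^ (D * b) & strategy_of N = Psi.
Proof.
move=> Hb H1 H3 HD.
pose L i := [seq y <- enum Psi | val y.2 == slot_time i].
pose f i := nth n [seq val y.1 | y <- L i] (i %% b).
have Hf i : f i < n.+1.
  rewrite /f; case: (ltnP (i %% b) (size [seq val y.1 | y <- L i])) => Hi.
    by have /mapP[y _ ->] := mem_nth n Hi; exact: ltnW (ltn_ord _).
  by rewrite nth_default.
have [N HN E] := digits_exist (D * b) Hf; exists N => //.
apply/setP => -[v t]; rewrite inE; apply/hasP/idP => /=.
  case=> i; rewrite mem_iota add0n => /andP[_ Hi] /andP[/eqP Ev /eqP Et].
  move: Ev; rewrite /digit E // /f.
  case: (ltnP (i %% b) (size [seq val y.1 | y <- L i])) => Hs; last first.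
    by rewrite nth_default // => Ev; have := ltn_ord v; lia.
  have /mapP[[v' t'] Hy ->] := mem_nth n Hs => /= /val_inj Ev; subst v'.
  move: Hy; rewrite mem_filter mem_enum /= => /andP[/eqP Et' Hy].
  by have <- : t' = t by apply: val_inj; rewrite /= Et'.
move=> Hy; have Ht := H1 _ _ Hy; have HtD : t <= D := HD _ Hy.
have HL i : slot_time i = t -> (v, t) \in L i.
  by move=> Ei; rewrite mem_filter mem_enum Hy /= Ei eqxx.
pose i0 := t.-1 * b.
have Hi0 : slot_time i0 = t by rewrite /slot_time /i0 mulnK // prednK.
pose j := index (v, t) (L i0).
have Hj : j < size (L i0) by rewrite index_mem HL.
have Hjb : j < b.
  apply: leq_trans Hj (leq_trans _ (H3 t)).
  have /card_uniqP<- : uniq (L i0) by rewrite filter_uniq ?enum_uniq.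
  apply: subset_leq_card; apply/subsetP => y.
  by rewrite mem_filter mem_enum inE Hi0 => /andP[Ey ->]; rewrite -val_eqE Ey.
have Hi : slot_time (i0 + j) = t.
  by rewrite /slot_time /i0 divnMDl // divn_small // addn0 prednK.
have Hlt : i0 + j < D * b by rewrite /i0; nia.
exists (i0 + j); first by rewrite mem_iota.
rewrite Hi eqxx andbT /digit E // /f.
have -> : L (i0 + j) = L i0 by rewrite /L Hi Hi0.
by rewrite /i0 modnMDl modn_small // (nth_map (v, t)) // nth_index ?HL.
Qed.

End Candidates.

(** * The search written as expressions, and its correctness *)

Section Algorithm.
Variables (b D : nat).

Definition nvertE := Inp (Cst 0).
Definition baseE := Plus nvertE (Cst 1).
Definition adjE u v := Inp (Plus (Cst 2) (Plus (Mul u nvertE) v)).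
Definition targetE v := Inp (Plus (Cst 2) (Plus (Mul nvertE nvertE) v)).
Definition digitE a i := Mod (Div a (Pow baseE i)) baseE.
(** A strategy has no times beyond the number of vertices, so a slot with a later time describes no
    pair. *)
Definition in_slotE a i v :=
  And (Eq (digitE a i) v) (Leq (Cst (slot_time b i)) nvertE).

(* In these expressions, variable c holds the number of a candidate strategy and
   variable v a vertex; the variables from v+1 on are free for local use. *)
Definition protectedE t c v :=
  Ors [seq in_slotE (Var c) i (Var v) | i <- slots b D & slot_time b i <= t].

(** The time [t] is fixed in advance and not read from the input, so the recursion unfolds into one
    expression; each level ranges over neighbours with the next variable. *)
Fixpoint burnedE t c v : expr :=
  if t is t'.+1 then
    Or (burnedE t' c v)
       (if 0 < t' then
          And (Not (protectedE t' c v))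
              (Ex v.+1 nvertE
                 (And (burnedE t' c v.+1) (adjE (Var v.+1) (Var v))))
        else Cst 0)
  else Eq (Var v) (Inp (Cst 1)).

(** Only the protection of burned vertices is tested: positive times and the budget hold for every
    candidate by the layout of the slots. *)
Definition invalidE c v :=
  Ex v nvertE
    (Ors [seq And (in_slotE (Var c) i (Var v)) (burnedE (slot_time b i) c v)
            | i <- slots b D]).

(** The added 1 separates a valid candidate saving nothing from an invalid one, whose score is 0. *)
Definition scoreE c v :=
  Mul (Not (invalidE c v))
      (Plus (Cst 1) (Sum v nvertE
         (And (targetE (Var v)) (Not (burnedE D.+1 c v))))).

Definition boundE := Pow baseE (D * b).

Definition optimalE c v :=
  Not (Ex v boundE (Not (Leq (scoreE v v.+1) (scoreE c v.+1)))).

(** An argmax written as a sum: round [N] counts as long as no number up to [N] is optimal, so the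
    total is the least optimal number, as in [sum_least]. *)
Definition bestE :=
  Sum 0 boundE (Not (Ex 1 (Plus (Var 0) (Cst 1)) (optimalE 1 2))).

(* Distinct slots may describe the same pair; only the first of them is output. *)
Definition printedE i :=
  And (And (Leq (Plus (digitE bestE i) (Cst 1)) nvertE)
           (Leq (Cst (slot_time b i)) nvertE))
      (Not (Ors [seq Eq (digitE bestE j) (digitE bestE i)
                   | j <- iota 0 i & slot_time b j == slot_time b i])).

Definition answerE : seq (expr * expr) :=
  flatten [seq [:: (printedE i, digitE bestE i); (printedE i, Cst (slot_time b i))]
             | i <- slots b D].

Variable x : instance.
Let n := nvert x.
Let w := encode x.
Let strat N := strategy_of b D n N.
Let burnedx Phi t := burned (@adj x) (source x) Phi t.
Implicit Types (r : nat -> nat) (a e : expr).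

Lemma eval_nvertE r : eval w r nvertE = n.
Proof. exact: encode_nvert. Qed.

Lemma eval_baseE r : eval w r baseE = n.+1.
Proof. by rewrite eval_Plus eval_nvertE addn1. Qed.

Lemma eval_adjE r a e (u v : 'I_n) : eval w r a = u -> eval w r e = v ->
  eval w r (adjE a e) = adj u v.
Proof.
move=> Ea Ee; rewrite eval_Inp !eval_Plus eval_Mul Ea Ee.
by rewrite eval_nvertE encode_adj.
Qed.

Lemma eval_targetE r e (v : 'I_n) : eval w r e = v ->
  eval w r (targetE e) = (v \in target x).
Proof.
move=> Ee; rewrite eval_Inp !eval_Plus eval_Mul Ee.
by rewrite eval_nvertE encode_target.
Qed.

Lemma eval_digitE r a i : eval w r (digitE a i) = digit n (eval w r a) i.
Proof.
by rewrite eval_Mod eval_baseE // eval_Div eval_Pow eval_baseE ?expn_gt0.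
Qed.

Lemma eval_boundE r : eval w r boundE = n.+1 ^ (D * b).
Proof. by rewrite eval_Pow eval_baseE. Qed.

Lemma eval_in_slotE r a i e : eval w r (in_slotE a i e) =
  (digit n (eval w r a) i == eval w r e) && (slot_time b i <= n).
Proof.
by rewrite eval_And eval_Eq eval_Leq eval_digitE eval_nvertE !bool_neq0.
Qed.

Lemma strategy_ofP N (y : 'I_n * 'I_#|'I_n|.+1) :
  reflect (exists2 i, i \in slots b D & digit n N i = y.1 /\ slot_time b i = y.2)
          (y \in strat N).
Proof.
rewrite inE; apply: (iffP hasP) => -[i Hi].
  by case/andP=> /eqP E1 /eqP E2; exists i.
by case=> E1 E2; exists i; rewrite ?E1 ?E2 ?eqxx.
Qed.

Lemma slot_timeK i : slot_time b i <= n -> exists t : 'I_#|'I_n|.+1, slot_time b i = t.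
Proof. by rewrite -ltnS -{1}(card_ord n) => Ht; exists (Ordinal Ht). Qed.

Lemma slot_time_leq (t : 'I_#|'I_n|.+1) : t <= n.
Proof. by case: t => m /=; rewrite card_ord. Qed.

Lemma eval_protectedE t c v r (u : 'I_n) : r v = u ->
  eval w r (protectedE t c v) = (u \in protected_by (strat (r c)) t).
Proof.
move=> Hv; rewrite eval_Ors; congr nat_of_bool.
apply/hasP/protected_byP => [[i Hi]|[y /strategy_ofP[i Hi [E1 E2]] [Ey Ht]]].
  rewrite eval_in_slotE bool_neq0 /= Hv => /andP[/eqP E1 /slot_timeK[t' Et]].
  move: Hi; rewrite mem_filter => /andP[Ht Hi].
  by exists (u, t'); [apply/strategy_ofP; exists i | rewrite -Et].
exists i; first by rewrite mem_filter Hi E2 Ht.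
by rewrite eval_in_slotE bool_neq0 /= Hv E1 Ey eqxx E2 slot_time_leq.
Qed.

(** The condition [c < v] keeps the candidate safe from the loops, whose variables start at [v.+1].
    The induction leaves [v] free because neighbours are examined in [v.+1]. *)
Lemma eval_burnedE t c v r (u : 'I_n) : c < v -> r v = u ->
  eval w r (burnedE t c v) = (u \in burnedx (strat (r c)) t).
Proof.
elim: t v r u => [|t IH] v r u Hc Hv.
  by rewrite eval_Eq eval_Inp encode_source [eval w r _]/= Hv inE.
rewrite [burnedE _ _ _]/= eval_Or (IH _ _ _ Hc Hv) bool_neq0 /burnedx in_burnedS.
congr (nat_of_bool (_ || _)); case: (0 < t) => //; rewrite andTb.
rewrite eval_And eval_Not (eval_protectedE _ _ Hv) eval_Ex !bool_neq0 eqb0.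
congr (_ && _); apply/existsP/existsP.
  case=> i; rewrite eval_And.
  have Hi : i < n by rewrite -(eval_nvertE r).
  have Hvi : upd r v.+1 i v.+1 = Ordinal Hi by rewrite /upd eqxx.
  have Hv' : upd r v.+1 i v = u by rewrite /upd ltn_eqF.
  have Hc' : upd r v.+1 i c = r c by rewrite /upd ltn_eqF //; lia.
  rewrite (IH _ _ (Ordinal Hi)) ?(eval_adjE (u := Ordinal Hi) (v := u)) //; last lia.
  by rewrite !bool_neq0 Hc' => H; exists (Ordinal Hi).
case=> u' Hu'.
have Hi : u' < eval w r nvertE by rewrite eval_nvertE.
exists (Ordinal Hi); rewrite eval_And [nat_of_ord (Ordinal Hi)]/=.
have Hvi : upd r v.+1 u' v.+1 = u' by rewrite /upd eqxx.
have Hv' : upd r v.+1 u' v = u by rewrite /upd ltn_eqF.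
have Hc' : upd r v.+1 u' c = r c by rewrite /upd ltn_eqF //; lia.
rewrite (IH _ _ u') ?(eval_adjE (u := u') (v := u)) //; last lia.
by rewrite !bool_neq0 Hc'.
Qed.

Definition no_burned_protected N : bool :=
  [forall y in strat N, y.1 \notin burnedx (strat N) y.2].

Lemma eval_invalidE c v r : c < v ->
  eval w r (invalidE c v) = ~~ no_burned_protected (r c).
Proof.
move=> Hc; rewrite eval_Ex negb_forall; congr nat_of_bool.
have Hc' i : upd r v i c = r c by rewrite /upd ltn_eqF.
apply/existsP/existsP => [[i]|[y]].
  rewrite eval_Ors bool_neq0 => /hasP[j Hj].
  have Hi : i < n by rewrite -(eval_nvertE r).
  have Hv : upd r v i v = Ordinal Hi by rewrite /upd eqxx.
  rewrite eval_And eval_in_slotE (eval_burnedE _ Hc Hv) !bool_neq0 /= Hc' Hv.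
  case/andP=> /andP[/eqP E1 /slot_timeK[t' Et]] Hb.
  exists (Ordinal Hi, t'); rewrite negb_imply negbK -Et Hb andbT.
  by apply/strategy_ofP; exists j.
rewrite negb_imply negbK => /andP[/strategy_ofP[j Hj [E1 E2]] Hb].
have Hi : y.1 < eval w r nvertE by rewrite eval_nvertE.
exists (Ordinal Hi); rewrite eval_Ors bool_neq0; apply/hasP; exists j => //.
have Hv : upd r v (Ordinal Hi) v = y.1 by rewrite /upd eqxx.
rewrite eval_And eval_in_slotE (eval_burnedE _ Hc Hv) !bool_neq0.
by rewrite [eval w _ (Var c)]/= [eval w _ (Var v)]/= !Hc' Hv E1 eqxx E2 slot_time_leq Hb.
Qed.

Definition score N : nat :=
  no_burned_protected N * #|target x :\: burnedx (strat N) D.+1|.+1.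

Lemma eval_scoreE c v r : c < v -> eval w r (scoreE c v) = score (r c).
Proof.
move=> Hc; rewrite eval_Mul eval_Not eval_invalidE // eqb0 negbK; congr (_ * _).
rewrite eval_Plus eval_Sum add1n eval_nvertE; congr _.+1.
rewrite -sum1_card [RHS]big_mkcond; apply: eq_bigr => i _.
have Hv : upd r v i v = i by rewrite /upd eqxx.
rewrite eval_And (eval_targetE (v := i)) // eval_Not (eval_burnedE _ Hc Hv) !bool_neq0 eqb0.
have -> : upd r v i c = r c by rewrite /upd ltn_eqF.
by rewrite in_setD andbC; case: (_ && _).
Qed.

Lemma eval_optimalE c v r : c < v ->
  eval w r (optimalE c v) = [forall N : 'I_(n.+1 ^ (D * b)), score N <= score (r c)].
Proof.
move=> Hc; rewrite eval_Not eval_Ex eqb0 negb_exists eval_boundE.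
congr nat_of_bool; apply: eq_forallb => i.
rewrite eval_Not eval_Leq !eval_scoreE ?eqb0 ?bool_neq0 ?negbK //; last exact: leqW.
by rewrite /upd eqxx ltn_eqF.
Qed.

Lemma eval_bestE r (N := eval w r bestE) :
  N < n.+1 ^ (D * b) /\ forall N', N' < n.+1 ^ (D * b) -> score N' <= score N.
Proof.
pose p N := [forall N' : 'I_(n.+1 ^ (D * b)), score N' <= score N].
have HM : 0 < n.+1 ^ (D * b) by rewrite expn_gt0.
have [i0 _ Hi0] := @arg_maxnP _ (Ordinal HM) xpredT (fun N : 'I__ => score N) isT.
have pi0 : p i0 by apply/forallP => N'; exact: Hi0.
have [] := sum_least (ltn_ord i0) pi0.
set M := \sum_(_ < _) _ => H1 H2.
have EN : N = M.
  rewrite /N eval_Sum eval_boundE; apply: eq_bigr => i _.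
  rewrite eval_Not eval_Ex eqb0 eval_Plus addn1; congr (nat_of_bool (~~ _)).
  apply: eq_existsb => j.
  by rewrite eval_optimalE // bool_neq0 /upd eqxx.
rewrite EN; split=> // N' HN'.
by have /forallP/(_ (Ordinal HN')) := H2.
Qed.

(** Every valid strategy with times at most [D] is a candidate of positive score. The empty strategy
    is one, so the best score is positive and the best candidate is valid; among valid ones the
    score orders by saved targets. *)
Lemma best_optimal r : 0 < b ->
    (forall p, path (@adj x) (source x) p -> uniq (source x :: p) -> size p <= D) ->
  optimal (@adj x) (source x) (target x) b (strat (eval w r bestE)).
Proof.
move=> Hb HD; have [_] := eval_bestE r; move: (eval w r bestE) => N Hmax.
have score_valid (Psi : strategy 'I_n) : valid (@adj x) (source x) b Psi ->
    (forall y, y \in Psi -> y.2 <= D) -> #|target x :\: burnedx Psi D.+1| < score N.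
  case=> H1 H2 H3 HPsi.
  have [N' HN' E] := strategy_of_surj Hb H1 H3 HPsi.
  apply: leq_trans (Hmax N' HN'); rewrite /score /strat E.
  suff -> : no_burned_protected N' by rewrite mul1n.
  by apply/forallP => -[u t]; rewrite /strat E; apply/implyP; exact: H2.
have Hok : no_burned_protected N.
  have valid0 : valid (@adj x) (source x) b set0.
    split=> [u t|u t|t]; rewrite ?inE //.
    by rewrite (_ : [set _ in _ | _] = set0) ?cards0 //; apply/setP => y; rewrite !inE.
  have H0 (y : 'I_n * 'I_#|'I_n|.+1) : y \in set0 -> y.2 <= D by rewrite inE.
  have := score_valid set0 valid0 H0.
  by rewrite /score; case: no_burned_protected.
apply: (optimalP HD) => [|Psi HPsi HPD].
  split=> [u t /strategy_of_time/andP[]//|u t Hut|t].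
    by have /forallP/(_ (u, t))/implyP/(_ Hut) := Hok.
  exact: (@strategy_of_budget b D n (source x)).
by have := score_valid _ HPsi HPD; rewrite /score Hok mul1n.
Qed.

Lemma answer_lists r :
  lists_strategy (outputs w r answerE) (strat (eval w r bestE)).
Proof.
set N := eval w r bestE.
pose g i : 'I_n * 'I_#|'I_n|.+1 := (insubd (source x) (digit n N i), inord (slot_time b i)).
pose P i := [&& digit n N i < n, slot_time b i <= n & ~~ has
  (fun j => digit n N j == digit n N i) [seq j <- iota 0 i | slot_time b j == slot_time b i]].
have EP i : eval w r (printedE i) = P i.
  rewrite !eval_And !eval_Leq eval_Not eval_Ors !bool_neq0 eqb0.
  rewrite eval_Plus addn1 eval_digitE eval_nvertE -andbA; congr nat_of_bool.
  congr [&& _, _ & ~~ _]; apply: eq_has => j.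
  by rewrite eval_Eq bool_neq0 !eval_digitE.
have Pg i : P i -> (g i).1 = digit n N i :> nat /\ (g i).2 = slot_time b i :> nat.
  by case/and3P=> H1 H2 _; rewrite /= insubdK // inordK // card_ord.
exists [seq g i | i <- slots b D & P i]; split.
- rewrite map_inj_in_uniq ?filter_uniq ?iota_uniq // => i j.
  rewrite !mem_filter => /andP[Pi _] /andP[Pj _] E.
  have [Ei1 Ei2] := Pg i Pi; have [Ej1 Ej2] := Pg j Pj.
  (* Of two slots describing the same pair, the earlier one suppresses the later. *)
  wlog Hij : i j Pi Pj E Ei1 Ei2 Ej1 Ej2 / i < j.
    move=> H; case: (ltngtP i j) => // Hij; first exact: (H i j).
    by apply/esym/(H j i).
  case/and3P: Pj => _ _ /hasP[]; exists i; last by rewrite -Ei1 -Ej1 E.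
  by rewrite mem_filter mem_iota add0n Hij -Ei2 -Ej2 E eqxx.
- move=> y; apply/mapP/strategy_ofP => [[i]|[i Hi [E1 E2]]].
    by rewrite mem_filter => /andP[/Pg[E1 E2] Hi ->]; exists i.
  have ex : exists j, (digit n N j == y.1) && (slot_time b j == y.2).
    by exists i; rewrite E1 E2 !eqxx.
  (* The least slot describing [y] is not suppressed, so [y] does get printed. *)
  case: (ex_minnP ex) => j /andP[/eqP F1 /eqP F2] Hmin.
  have Hji : j <= i by apply: Hmin; rewrite E1 E2 !eqxx.
  have Pj : P j.
    rewrite /P F1 F2 ltn_ord slot_time_leq /=; apply/hasPn => k.
    rewrite mem_filter mem_iota add0n => /and3P[Ek _ Hk].
    by apply: contraL Hk => Ek'; rewrite -leqNgt; apply: Hmin; rewrite Ek' Ek.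
  exists j; last first.
    have [G1 G2] := Pg j Pj.
    by case: y {E1 E2 ex Hmin Pj} F1 F2 G1 G2 => y1 y2 /= F1 F2 G1 G2;
       congr pair; apply: val_inj; rewrite /= ?G1 ?G2.
  rewrite mem_filter Pj mem_iota; move: Hi; rewrite mem_iota; lia.
rewrite outputs_pairs -map_comp (eq_filter (a2 := P)) => [|i]; last by rewrite EP bool_neq0.
congr flatten; elim: (slots b D) => // i l IH; rewrite [filter _ _]/=.
case: ifP => // /Pg[G1 G2].
rewrite map_cons IH map_cons eval_digitE -G1; congr ([:: _; _] :: _); exact: esym G2.
Qed.

End Algorithm.

Theorem theorem2 (k b : nat) (hk : 1 <= k) (hb : 1 <= b) :
  poly_time_solvable_on encode (fun x => is_kstar k (@adj x)) (solves_max_save b).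
Proof.
(* The horizon [k.*2] depends on [k] alone, so a single program serves all instances. *)
apply: (outputs_poly_time (l := answerE b k.*2)) => [x i|x Hx].
  exact: encode_leq_bit_length.
exists (strategy_of b k.*2 (nvert x) (eval (encode x) (fun=> 0) (bestE b k.*2))).
split; last exact: answer_lists.
by apply: best_optimal => // p; exact: kstar_path_size.
Qed.
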